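(* The following relations hold among the classes $\mathcal{G}_i^j$ ($i,j\in\{s,w,a\}$): $$\mathcal{G}_s^s=\mathcal{G}_w^s\subsetneq\mathcal{G}_s^w\subsetneq\mathcal{G}_w^w=\mathcal{G}_a^w=\mathcal{G}_s^a=\mathcal{G}_w^a=\mathcal{G}_a^a,$$ and $\mathcal{G}_s^s\subsetneq\mathcal{G}_a^s\subsetneq\mathcal{G}_w^w$. Moreover, there is no inclusion relationship between $\mathcal{G}_a^s$ and $\mathcal{G}_s^w$, i.e., $\mathcal{G}_a^s\not\subseteq\mathcal{G}_s^w$ and $\mathcal{G}_s^w\not\subseteq\mathcal{G}_a^s$.
   Context: Graphs are finite and simple. A finite point set $X\subseteq\mathbb{R}^2$ is strictly convex if every point of $X$ is a vertex of the convex hull of $X$, and weakly convex if $X$ lies on the boundary of its convex hull. A drawing of a graph $G$ is a map $f:V(G)\to\mathbb{R}^2$, edges being drawn as straight line segments between their endpoints, such that no two vertices coincide, no two midpoints of edges coincide, and no midpoint of an edge coincides with a vertex. For $i,j\in\{s,w,a\}$, $\mathcal{G}_i^j$ is the class of graphs admitting a drawing in which the set of (images of) vertices is strictly convex if $i=s$, weakly convex if $i=w$, arbitrary if $i=a$, and the set of midpoints of edges is strictly convex if $j=s$, weakly convex if $j=w$, arbitrary if $j=a$. *)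

(* Defs.v *)
From HB Require Import structures.
From mathcomp Require Export all_boot all_order all_algebra.
From mathcomp Require Export all_classical all_reals all_analysis.

Set Implicit Arguments.
Unset Strict Implicit.
Unset Printing Implicit Defensive.

Import Order.TTheory GRing.Theory Num.Theory.
Import numFieldNormedType.Exports.

Local Open Scope classical_set_scope.
Local Open Scope ring_scope.

Record sgraph := SGraph {
  vertex :> finType;
  adj : rel vertex;
  adj_sym : symmetric adj;
  adj_irrefl : irreflexive adj
}.

Notation plane R := 'rV[R]_2.

Definition convex_hull (R : realType) (X : set (plane R)) : set (plane R) :=
  smallest (@convex_set R (plane R)) X.

(* Topological boundary in the plane: a set with empty interior, such as a
   segment, is contained in its own boundary. *)
Definition boundary (R : realType) (A : set (plane R)) : set (plane R) :=
  closure A `\` interior A.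

(* The vertices of a convex polygon (possibly degenerate to a segment or a
   point) are its extreme points. *)
Definition is_vertex (R : realType) (A : set (plane R)) (p : plane R) : Prop :=
  A p /\
  forall (x y : plane R) (t : R), A x -> A y -> 0 < t -> t < 1 ->
    p = (1 - t) *: x + t *: y -> x = y.

Definition strictly_convex (R : realType) (X : set (plane R)) : Prop :=
  X `<=` is_vertex (convex_hull X).

Definition weakly_convex (R : realType) (X : set (plane R)) : Prop :=
  X `<=` boundary (convex_hull X).

Inductive position := Strict | Weak | Arbitrary.

Definition in_position (R : realType) (i : position) (X : set (plane R)) : Prop :=
  match i with
  | Strict => strictly_convex X
  | Weak => weakly_convex X
  | Arbitrary => True
  end.

Definition midpoint (R : realType) (p q : plane R) : plane R :=
  2^-1 *: (p + q).

Definition is_drawing (R : realType) (G : sgraph) (f : G -> plane R) : Prop :=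
  [/\ injective f,
      (forall u v x y : G, adj u v -> adj x y ->
         midpoint (f u) (f v) = midpoint (f x) (f y) ->
         [set u; v]%SET = [set x; y]%SET)
    & (forall u v x : G, adj u v -> midpoint (f u) (f v) <> f x)].

Definition edge_midpoints (R : realType) (G : sgraph) (f : G -> plane R) :
    set (plane R) :=
  [set p | exists u v : G, adj u v /\ p = midpoint (f u) (f v)].

(* A class of graphs is a plain predicate: for universe reasons the type sgraph
   cannot be an argument of the library's set. *)
Definition graph_class (R : realType) (i j : position) (G : sgraph) : Prop :=
  exists f : G -> plane R,
    [/\ is_drawing f,
        in_position i (range f)
      & in_position j (edge_midpoints f)].

Definition class_eq (C D : sgraph -> Prop) : Prop := forall G, C G <-> D G.

Definition class_sub (C D : sgraph -> Prop) : Prop := forall G, C G -> D G.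

Definition class_proper (C D : sgraph -> Prop) : Prop :=
  class_sub C D /\ ~ class_sub D C.

(* Main.v *)
Require Import Defs.
From mathcomp Require Import ring lra zify.

(** Everything is reduced to linear functionals [dot w]: for a finite set,
    strict (resp. weak) convexity means that every point is the unique maximiser
    of some functional (resp. a maximiser of some nonzero functional).  This is
    Farkas' lemma in the plane.

    Points on a line give Weak-Weak drawings, and points on a parabola
    Strict-Arbitrary drawings, of every graph.  A Weak-Strict drawing becomes
    Strict-Strict by slightly bending the sides of its hull outwards, because
    strict convexity of the midpoints is an open condition.

    [K4] separates Arbitrary-Strict from Strict-Weak: a triangle with its
    barycentre gives a hexagon of midpoints, whereas in a convex quadrilateral
    the midpoints of the diagonals are interior to the parallelogram of the
    midpoints of the sides.  [K23] separates in the other direction: up to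
    scaling, its midpoints are two translates of a triangle, which are never in
    strictly convex position, but which lie on two lines when the translation is
    parallel to a side. *)

Set Implicit Arguments.
Unset Strict Implicit.
Unset Printing Implicit Defensive.

Import Order.TTheory GRing.Theory Num.Theory.
Import numFieldNormedType.Exports.

Local Open Scope classical_set_scope.
Local Open Scope ring_scope.

(** * Convexity in the plane *)

Section Plane.
Variable R : realType.
Implicit Types (p q w e d : plane R) (A C X : set (plane R)) (D : seq (plane R)).

Definition dot w p : R := w 0 0 * p 0 0 + w 0 1 * p 0 1.

Definition point (x y : R) : plane R := \row_j (if j == 0 then x else y).

Lemma plane_eq p q : p 0 0 = q 0 0 -> p 0 1 = q 0 1 -> p = q.
Proof.
move=> h0 h1; apply/rowP => j.
by case: j => [[|[|//]] j2]; [move: h0|move: h1]; congr (_ = _);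
  congr (fun_of_matrix _ _ _); apply/val_inj.
Qed.

Lemma dotDr w p q : dot w (p + q) = dot w p + dot w q.
Proof. by rewrite /dot !mxE; ring. Qed.

Lemma dotNr w p : dot w (- p) = - dot w p.
Proof. by rewrite /dot !mxE; ring. Qed.

Lemma dotBr w p q : dot w (p - q) = dot w p - dot w q.
Proof. by rewrite dotDr dotNr. Qed.

Lemma dotZr w t p : dot w (t *: p) = t * dot w p.
Proof. by rewrite /dot !mxE; ring. Qed.

Lemma dotDl w w' p : dot (w + w') p = dot w p + dot w' p.
Proof. by rewrite /dot !mxE; ring. Qed.

Lemma dotZl t w p : dot (t *: w) p = t * dot w p.
Proof. by rewrite /dot !mxE; ring. Qed.

Lemma dotC p q : dot p q = dot q p.
Proof. by rewrite /dot; ring. Qed.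

Lemma dot0l p : dot 0 p = 0.
Proof. by rewrite /dot !mxE; ring. Qed.

Definition dotE := (dotDr, dotNr, dotZr, dotDl, dotZl).

Lemma dot_gt0 p : p != 0 -> 0 < dot p p.
Proof.
move=> p0; rewrite lt_def; apply/andP; split; last first.
  by rewrite /dot addr_ge0 // -expr2 sqr_ge0.
apply: contra_neq p0; rewrite /dot -!expr2 => /eqP.
rewrite paddr_eq0 ?sqr_ge0 // !sqrf_eq0 => /andP[/eqP h0 /eqP h1].
by apply: plane_eq; rewrite mxE.
Qed.

(** The vector [point (- e 0 1) (e 0 0)] is [e] turned by a right angle. *)
Lemma colinear_of_perp e q : e != 0 -> dot (point (- e 0 1) (e 0 0)) q = 0 ->
  q = (dot e q / dot e e) *: e.
Proof.
move=> /dot_gt0 ee; rewrite /dot !mxE /= => q0.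
have ne : e 0 0 * e 0 0 + e 0 1 * e 0 1 != 0 by rewrite gt_eqF.
apply/esym/plane_eq; rewrite !mxE; apply: (mulIf ne); rewrite mulrAC divfK //.
  have := congr1 ( *%R (e 0 1)) q0; rewrite mulr0; lra.
have := congr1 ( *%R (e 0 0)) q0; rewrite mulr0; lra.
Qed.

Lemma dot_midpoint w p q : dot w (midpoint p q) = 2^-1 * (dot w p + dot w q).
Proof. by rewrite /midpoint dotZr dotDr. Qed.

Lemma convex_setP C :
  convex_set (C : set (convex_lmodType (plane R))) <->
  forall p q (t : R), C p -> C q -> 0 < t -> t < 1 -> C (t *: p + (1 - t) *: q).
Proof.
rewrite convex_setW; split=> [cC p q t Cp Cq t0 t1|cC p q].
  have t01 : Itv.spec (Itv.num_sem (R := R)) (Itv.Real `[0%Z, 1%Z]) t.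
    by rewrite /= /Itv.num_sem /= num_real in_itv /= (ltW t0) (ltW t1).
  have := cC p q (mem_set Cp) (mem_set Cq) (Itv.mk t01) t0 t1.
  by rewrite inE.
by rewrite !inE => Cp Cq k k0 k1; rewrite inE; apply: cC.
Qed.

Lemma convex_comb C p q (t : R) :
  convex_set (C : set (convex_lmodType (plane R))) ->
  C p -> C q -> 0 <= t -> t <= 1 -> C (t *: p + (1 - t) *: q).
Proof.
move=> /convex_setP cC Cp Cq; rewrite le_eqVlt => /predU1P[<-|t0].
  by rewrite scale0r add0r subr0 scale1r.
rewrite le_eqVlt => /predU1P[->|t1]; last exact: cC.
by rewrite subrr scale0r addr0 scale1r.
Qed.

Lemma convex_hull_convex X :
  convex_set (convex_hull X : set (convex_lmodType (plane R))).
Proof.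
apply/convex_setP => p q t Xp Xq t0 t1 C [cC XC].
by move/convex_setP: (cC); apply => //; [apply: Xp|apply: Xq].
Qed.

Lemma sub_convex_hull X : X `<=` convex_hull X.
Proof. exact: sub_gen_smallest. Qed.

Lemma convex_hull_min X C :
  convex_set (C : set (convex_lmodType (plane R))) -> X `<=` C ->
  convex_hull X `<=` C.
Proof. exact: smallest_sub. Qed.

Lemma half_plane_convex w (a : R) :
  convex_set ([set p | dot w p <= a] : set (convex_lmodType (plane R))).
Proof.
apply/convex_setP => p q t /= hp hq t0 t1; rewrite !dotE; nra.
Qed.

Lemma interiorP A p : interior A p <->
  exists2 r : R, 0 < r & forall q, `|p 0 0 - q 0 0| < r ->
    `|p 0 1 - q 0 1| < r -> A q.
Proof.
rewrite /interior /=; split=> [/nbhs_ballP[r /= r0 rA]|[r r0 rA]].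
  exists r => // q h0 h1; apply: rA; split=> // i j; rewrite ord1.
  by case: j => [[|[|//]] j2] /=; [move: h0|move: h1]; rewrite /ball /=;
   congr (is_true (`|_ - _| < _)); congr (fun_of_matrix _ _ _); apply/val_inj.
by apply/nbhs_ballP; exists r => //= q pq; apply: rA; apply: pq.2.
Qed.

(** An interior point is the midpoint of a short horizontal segment inside [A]. *)
Lemma is_vertex_boundary A p : is_vertex A p -> boundary A p.
Proof.
move=> [Ap ext]; split; first exact: subset_closure.
move=> /interiorP[r r0 rA].
have r2 : 0 < r / 2 by rewrite divr_gt0.
pose x := p + point (r / 2) 0; pose y := p - point (r / 2) 0.
have Ax : A x.
  by apply: rA; rewrite !mxE /= ?addr0 ?subrr ?normr0 // opprD addNKr normrN gtr0_norm; lra.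
have Ay : A y.
  by apply: rA; rewrite !mxE /= ?oppr0 ?addr0 ?subrr ?normr0 // opprB addrC subrK gtr0_norm; lra.
have /rowP/(_ 0) : x = y.
  have pE : p = (1 - 2^-1) *: x + 2^-1 *: y.
    by apply: plane_eq; rewrite /x /y !mxE /=; field.
  by apply: (ext x y 2^-1) pE => //; lra.
by rewrite !mxE /=; lra.
Qed.

(** The hull stays in the half-plane supported at [p], and any step from [p] in the direction [w]
    leaves it. *)
Lemma supported_boundary X w p : w != 0 -> X p ->
  (forall q, X q -> dot w q <= dot w p) -> boundary (convex_hull X) p.
Proof.
move=> w0 Xp wp; split; first by apply: subset_closure; apply: sub_convex_hull.
move=> /interiorP[r r0 rX].
pose m := 1 + `|w 0 0| + `|w 0 1|.
have m0 : 0 < m by rewrite /m; have := normr_ge0 (w 0 0); have := normr_ge0 (w 0 1); lra.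
pose s := r / m / 2.
have s0 : 0 < s by rewrite /s !divr_gt0.
have sm : s * m = r / 2 by rewrite /s; field; rewrite gt_eqF.
have : convex_hull X (p + s *: w).
  apply: rX; rewrite !mxE opprD addNKr normrN normrM gtr0_norm //.
    have := normr_ge0 (w 0 1); have : s * `|w 0 0| <= s * m; last lra.
    by rewrite ler_pM2l // /m; have := normr_ge0 (w 0 1); lra.
  have := normr_ge0 (w 0 1); have : s * `|w 0 1| <= s * m; last lra.
  by rewrite ler_pM2l // /m; have := normr_ge0 (w 0 0); lra.
move=> /(convex_hull_min (half_plane_convex (a := dot w p)) wp) /=.
rewrite !dotE gerDl leNgt pmulr_rgt0 //; apply/negP/negPn.
exact: dot_gt0.
Qed.

Lemma convex_comb3 C p q q' (a b c : R) :
  convex_set (C : set (convex_lmodType (plane R))) ->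
  C p -> C q -> C q' -> 0 < a -> 0 < b -> 0 < c -> a + b + c = 1 ->
  C (a *: p + b *: q + c *: q').
Proof.
move=> /convex_setP cC Cp Cq Cq' a0 b0 c0 abc.
have ab0 : 0 < a + b by lra.
have Cpq : C ((a / (a + b)) *: p + (1 - a / (a + b)) *: q).
  apply: cC => //; first exact: divr_gt0.
  by rewrite ltr_pdivrMr // mul1r; lra.
have {Cpq} := cC _ _ (a + b) Cpq Cq' ab0; rewrite (_ : 1 - (a + b) = c); last lra.
rewrite scalerDr !scalerA mulrBr mulr1 mulrC divfK ?gt_eqF //.
by rewrite [a + b - a]addrC addKr; apply; lra.
Qed.

Lemma convex_shrink C p e (s t : R) :
  convex_set (C : set (convex_lmodType (plane R))) ->
  C p -> C (p + s *: e) -> 0 < t -> t <= s -> C (p + t *: e).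
Proof.
move=> cC Cp Cs t0 ts; have s0 : 0 < s by lra.
rewrite [X in C X](_ : _ = (t / s) *: (p + s *: e) + (1 - t / s) *: p).
  apply: convex_comb => //; first by rewrite divr_ge0 // ltW.
  by rewrite ler_pdivrMr // mul1r.
by apply: plane_eq; rewrite !mxE; field; rewrite gt_eqF.
Qed.

(** Three directions suffice: the points found along them, shrunk to a common factor [m], form a
    triangle around [p]. *)
Lemma interior_of_directions C p :
  convex_set (C : set (convex_lmodType (plane R))) -> C p ->
  (forall e, e != 0 -> exists2 s : R, 0 < s & C (p + s *: e)) ->
  interior C p.
Proof.
move=> cC Cp dirC; apply/interiorP.
have nz0 (x y : R) : x != 0 -> point x y != 0.
  by apply: contra_neq => /rowP/(_ 0); rewrite !mxE.
have nz1 (x y : R) : y != 0 -> point x y != 0.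
  by apply: contra_neq => /rowP/(_ 1); rewrite !mxE.
have [|r r0 Cr] := dirC (point 1 0); first by rewrite nz0 ?oner_eq0.
have [|s s0 Cs] := dirC (point 0 1); first by rewrite nz1 ?oner_eq0.
have [|t t0 Ct] := dirC (point (-1) (-1)); first by rewrite nz0 ?oppr_eq0 ?oner_eq0.
pose m := Num.min r (Num.min s t).
have m0 : 0 < m by rewrite !lt_min r0 s0.
have {}Cr : C (p + m *: point 1 0) by apply: convex_shrink Cr _ _ => //; rewrite ge_min lexx.
have {}Cs : C (p + m *: point 0 1).
  by apply: convex_shrink Cs _ _ => //; rewrite !ge_min lexx orbT.
have {}Ct : C (p + m *: point (-1) (-1)).
  by apply: convex_shrink Ct _ _ => //; rewrite !ge_min lexx !orbT.
exists (m / 9); first by rewrite divr_gt0.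
move=> q; rewrite !ltr_norml => /andP[x0 x1] /andP[y0 y1].
pose x := (q 0 0 - p 0 0) / m; pose y := (q 0 1 - p 0 1) / m.
have m1 : m != 0 by rewrite gt_eqF.
have xlt : x < 9^-1 by rewrite /x ltr_pdivrMr //; lra.
have ylt : y < 9^-1 by rewrite /y ltr_pdivrMr //; lra.
have xgt : - 9^-1 < x by rewrite /x ltr_pdivlMr //; lra.
have ygt : - 9^-1 < y by rewrite /y ltr_pdivlMr //; lra.
(* [x + c], [y + c] and [c] are the barycentric coordinates of [q] in the triangle; the radius
   [m / 9] keeps them positive. *)
pose c := (1 - x - y) / 3.
have -> : q = (x + c) *: (p + m *: point 1 0) + (y + c) *: (p + m *: point 0 1)
            + c *: (p + m *: point (-1) (-1)).
  by apply: plane_eq; rewrite !mxE /= /c /x /y; field.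
by apply: convex_comb3 => //; rewrite /c; lra.
Qed.

Lemma seq_min (s : seq R) : exists m, forall x, x \in s -> m <= x.
Proof.
elim: s => [|y s [m ms]]; first by exists 0.
exists (Num.min y m) => x; rewrite inE => /predU1P[->|/ms mx].
  by rewrite ge_min lexx.
by rewrite ge_min mx orbT.
Qed.

Lemma seq_separation (L U : seq R) :
  (forall l u, l \in L -> u \in U -> l <= u) ->
  exists y, (forall l, l \in L -> l <= y) /\ (forall u, u \in U -> y <= u).
Proof.
elim: L => [_|l L IH LU].
  by have [m mU] := seq_min U; exists m.
have [|y [Ly yU]] := IH; first by move=> l' u l'L; apply: LU; rewrite inE l'L orbT.
exists (Num.max l y); split=> [l'|u uU].
  by rewrite inE => /predU1P[->|/Ly]; rewrite le_max ?lexx // => ->; rewrite orbT.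
by rewrite ge_max yU // LU // mem_head.
Qed.

(* Fourier-Motzkin elimination in the coordinates [dot e] and [dot e'], where
   [e'] is [e] turned by a right angle: the sought functional is [y e' - e]. *)
Lemma farkas C D e :
  convex_set (C : set (convex_lmodType (plane R))) ->
  (forall d, d \in D -> C d) -> e != 0 ->
  (exists2 w, dot w e < 0 & forall d, d \in D -> 0 <= dot w d) \/
  (exists2 s : R, 0 < s & C (s *: e)).
Proof.
move=> cC DC e0; have ee := dot_gt0 e0.
have [|noC] := pselect (exists2 s : R, 0 < s & C (s *: e)); [by right|left].
pose e' := point (- e 0 1) (e 0 0).
have onC q : C q -> dot e' q = 0 -> dot e q <= 0.
  move=> Cq; rewrite leNgt => q0; apply/negP => q1; apply: noC.
  exists (dot e q / dot e e); first exact: divr_gt0.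
  by rewrite -colinear_of_perp.
(* The condition [dot e d <= y * dot e' d] bounds [y] from below when [dot e' d] is positive and
   from above when it is negative; when it is zero, the condition is [onC]. *)
pose L := [seq dot e d / dot e' d | d <- D & 0 < dot e' d].
pose U := [seq dot e d / dot e' d | d <- D & dot e' d < 0].
have [|y [Ly yU]] := @seq_separation L U.
  move=> l u /mapP[d]; rewrite mem_filter => /andP[d0 /DC Cd] ->.
  move=> /mapP[d']; rewrite mem_filter => /andP[d'0 /DC Cd'] ->.
  set b := dot e' d in d0 *; set b' := dot e' d' in d'0 *.
  have bb : 0 < b - b' by lra.
  (* With this weight the combination of [d] and [d'] is annihilated by [dot e'], so [onC] compares
     the two bounds. *)
  have t0 : 0 <= - b' / (b - b') by rewrite divr_ge0 //; lra.
  have t1 : - b' / (b - b') <= 1 by rewrite ler_pdivrMr // mul1r; lra.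
  have := onC _ (convex_comb cC Cd Cd' t0 t1).
  rewrite !dotE -/b -/b'.
  have -> : - b' / (b - b') * b + (1 - - b' / (b - b')) * b' = 0.
    by field; rewrite gt_eqF.
  have -> : - b' / (b - b') * dot e d + (1 - - b' / (b - b')) * dot e d' =
            (b * dot e d' - b' * dot e d) / (b - b').
    by field; rewrite gt_eqF.
  move=> /(_ erefl); rewrite ler_pdivrMr // mul0r => h.
  by rewrite ler_pdivrMr // mulrAC ler_ndivlMr //; lra.
exists (y *: e' - e).
  by rewrite !dotE -scaleN1r dotZl (_ : dot e' e = 0) ?mulr0 ?add0r; [lra|rewrite /dot !mxE /=; ring].
move=> d dD; rewrite -scaleN1r !dotE mulN1r subr_ge0.
have [b0|b0|b0] := ltrgtP (dot e' d) 0.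
- rewrite -ler_ndivlMr //; apply: yU; apply/mapP; exists d => //.
  by rewrite mem_filter b0.
- rewrite -ler_pdivrMr //; apply: Ly; apply/mapP; exists d => //.
  by rewrite mem_filter b0.
- by rewrite b0 mulr0; apply: onC => //; apply: DC.
Qed.

End Plane.

(** * Supporting functionals of finite sets *)

Section Positions.
Variable R : realType.
Implicit Types (p q w e d : plane R) (A C X : set (plane R)) (D : seq (plane R)).

(** Farkas' lemma for [- d] gives a functional positive at [d] and nonnegative on [D]; these are
    summed over [d]. Its other alternative would put [0] on a segment between [d] and a negative
    multiple of [d], both in [C]. *)
Lemma strict_separation C D :
  convex_set (C : set (convex_lmodType (plane R))) ->
  (forall d, d \in D -> C d) -> ~ C 0 ->
  exists w, forall d, d \in D -> 0 < dot w d.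
Proof.
move=> cC DC C0.
suff /(_ D) [] : forall s : seq (plane R), {subset s <= D} -> exists w,
    (forall d, d \in s -> 0 < dot w d) /\ (forall d, d \in D -> 0 <= dot w d).
- by [].
- by move=> w [wD _]; exists w.
elim=> [_|d s IH sD].
  by exists 0; split => // d _; rewrite dot0l.
have [|w [ws wD]] := IH; first by move=> x xs; apply: sD; rewrite inE xs orbT.
have Cd : C d by apply/DC/sD/mem_head.
have d0 : - d != 0 by rewrite oppr_eq0; apply: contra_notN C0 => /eqP <-.
have [[w' w'd w'D]|[r r0 Cr]] := farkas cC DC d0.
  exists (w + w'); split=> [x|x xD]; rewrite dotDl; last first.
    by rewrite addr_ge0 ?wD ?w'D.
  rewrite inE => /predU1P[->|xs].
    by rewrite ltr_wpDl ?wD ?sD ?mem_head //; move: w'd; rewrite dotNr oppr_lt0.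
  by rewrite ltr_pwDl ?ws ?w'D // sD // inE xs orbT.
case: C0; rewrite [X in C X](_ : _ = (r / (1 + r)) *: d + (1 - r / (1 + r)) *: (r *: - d)).
  apply: convex_comb => //; first by rewrite divr_ge0 //; lra.
  by rewrite ler_pdivrMr; lra.
by apply: plane_eq; rewrite !mxE; field; rewrite gt_eqF //; lra.
Qed.

(** As [p] is extreme, the hull without [p] is still convex. Translated by [- p] it is the set [C],
    which avoids [0]. *)
Lemma strict_functional X p : finite_set X -> strictly_convex X -> X p ->
  exists w, forall q, X q -> q <> p -> dot w q < dot w p.
Proof.
move=> /finite_seqP[s ->] {X}; set X := [set` s] => scX Xp.
have [_ ext] := scX p Xp.
pose C : set (plane R) := [set d | convex_hull X (p + d) /\ d <> 0].
pose D := [seq q - p | q <- s & q != p].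
have cC : convex_set (C : set (convex_lmodType (plane R))).
  apply/convex_setP => d d' t [Cd d0] [Cd' d'0] t0 t1.
  have pE : p + (t *: d + (1 - t) *: d') = t *: (p + d) + (1 - t) *: (p + d').
    by apply: plane_eq; rewrite !mxE; ring.
  split.
    by rewrite pE; apply: convex_comb (@convex_hull_convex _ _) _ _ _ _ => //; apply: ltW.
  move=> dd; move: pE; rewrite dd addr0 => pE.
  have : p + d = p + d'.
    apply: (ext _ _ (1 - t)) => //; [lra|lra|].
    by rewrite subKr.
  move=> /addrI dd'; apply: d0; move: dd; rewrite -dd' -scalerDl.
  by rewrite addrC subrK scale1r.
have DC d : d \in D -> C d.
  move=> /mapP[q]; rewrite mem_filter => /andP[qp qs] ->.
  rewrite /C /= addrC subrK; split; first exact: sub_convex_hull.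
  by apply/eqP; rewrite subr_eq0.
have [|w wD] := strict_separation cC DC; first by case.
exists (- w) => q qs /eqP qp; rewrite -scaleN1r !dotZl !mulN1r ltrN2.
have /wD : q - p \in D by apply/mapP; exists q => //; rewrite mem_filter qp.
by rewrite dotBr subr_gt0.
Qed.

(** The open half-plane below [p], with the single point [p] added, is convex, contains [X], and has
    [p] as an extreme point. *)
Lemma strictly_convex_of_functional X :
  (forall p, X p -> exists w, forall q, X q -> q <> p -> dot w q < dot w p) ->
  strictly_convex X.
Proof.
move=> H p Xp; have [w wp] := H p Xp.
split; first exact: sub_convex_hull.
pose S : set (plane R) := [set q | q = p \/ dot w q < dot w p].
have XS : convex_hull X `<=` S.
  apply: convex_hull_min; last first.
    by move=> q Xq; have [->|/eqP qp] := eqVneq q p; [left|right; apply: wp].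
  apply/convex_setP => q q' t Sq Sq' t0 t1.
  case: Sq => [->|hq]; case: Sq' => [->|hq'].
  - by left; rewrite -scalerDl addrC subrK scale1r.
  - by right; rewrite !dotE; nra.
  - by right; rewrite !dotE; nra.
  - by right; rewrite !dotE; nra.
move=> x y t /XS Sx /XS Sy t0 t1 pE.
have := congr1 (dot w) pE; rewrite !dotE.
case: Sx => [->|hx]; case: Sy => [->|hy] // h; exfalso; nra.
Qed.

(** Without such a functional, Farkas' lemma finds a point of the hull beyond [p] in every
    direction, so [p] is interior. *)
Lemma weak_functional X p : finite_set X -> weakly_convex X -> X p ->
  exists2 w, w != 0 & forall q, X q -> dot w q <= dot w p.
Proof.
move=> /finite_seqP[s ->] {X}; set X := [set` s] => wcX Xp.
have [_ nint] := wcX p Xp.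
apply: contra_notP nint => nw; apply: interior_of_directions.
- exact: convex_hull_convex.
- exact: sub_convex_hull.
move=> e e0.
pose C : set (plane R) := [set d | convex_hull X (p + d)].
have cC : convex_set (C : set (convex_lmodType (plane R))).
  apply/convex_setP => d d' t Cd Cd' t0 t1; rewrite /C /=.
  have -> : p + (t *: d + (1 - t) *: d') = t *: (p + d) + (1 - t) *: (p + d').
    by apply: plane_eq; rewrite !mxE; ring.
  by apply: convex_comb (@convex_hull_convex _ _) _ _ _ _ => //; apply: ltW.
have DC d : d \in [seq q - p | q <- s] -> C d.
  move=> /mapP[q qs ->]; rewrite /C /= addrC subrK; exact: sub_convex_hull.
have [[w we wD]|//] := farkas cC DC e0.
case: nw; exists (- w).
  by rewrite oppr_eq0; apply: contraTneq we => ->; rewrite dot0l ltxx.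
move=> q qs; rewrite -scaleN1r !dotZl !mulN1r lerN2.
have /wD : q - p \in [seq q - p | q <- s] by apply: map_f.
by rewrite dotBr subr_ge0.
Qed.

Lemma weakly_convex_of_functional X :
  (forall p, X p -> exists2 w, w != 0 & forall q, X q -> dot w q <= dot w p) ->
  weakly_convex X.
Proof. by move=> H p Xp; have [w w0 wp] := H p Xp; apply: supported_boundary wp. Qed.

Lemma strictly_convex_weakly X : strictly_convex X -> weakly_convex X.
Proof. by move=> scX p /scX; apply: is_vertex_boundary. Qed.

Section Drawing.
Variables (G : sgraph) (f : G -> plane R).

Lemma finite_range : finite_set (range f).
Proof. exact/finite_image/finite_finset. Qed.

Lemma finite_edge_midpoints : finite_set (edge_midpoints f).
Proof.
apply: (@sub_finite_set _ _ (range (fun uv : G * G => midpoint (f uv.1) (f uv.2)))).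
  by move=> p [u [v [_ ->]]]; exists (u, v).
exact/finite_image/finite_finset.
Qed.

Lemma edge_midpoints_adj u v : adj u v -> edge_midpoints f (midpoint (f u) (f v)).
Proof. by exists u, v. Qed.

End Drawing.
End Positions.

(** * Drawings of all graphs *)

(** Two powers with exponents below [l] add up to less than [3 ^ l], so the sum determines the
    larger exponent. The case [k = l] will keep midpoints away from vertices. *)
Lemma expn3_sidon (i j k l : nat) : (3 ^ i + 3 ^ j = 3 ^ k + 3 ^ l)%N ->
  (i = k /\ j = l) \/ (i = l /\ j = k).
Proof.
have lt (i' j' k' l' : nat) : (i' <= j' -> j' < l' -> 3 ^ i' + 3 ^ j' < 3 ^ k' + 3 ^ l')%N.
  move=> ij jl; have h1 : (3 ^ i' <= 3 ^ j')%N by rewrite leq_exp2l.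
  have h2 : (3 * 3 ^ j' <= 3 ^ l')%N by rewrite -expnS leq_exp2l.
  have h3 : (0 < 3 ^ j')%N by rewrite expn_gt0.
  have h4 : (0 < 3 ^ k')%N by rewrite expn_gt0.
  move: h1 h2 h3 h4; clear; move: (3 ^ i')%N (3 ^ j')%N (3 ^ k')%N (3 ^ l')%N => *; lia.
wlog ij : i j / (i <= j)%N => [hw|].
  have [/hw //|/ltnW /hw h e] := leqP i j.
  by rewrite addnC in e; have [[-> ->]|[-> ->]] := h e; [right|left].
wlog kl : k l / (k <= l)%N => [hw|e].
  have [/hw //|/ltnW /hw h e] := leqP k l.
  by rewrite [RHS]addnC in e; have [[-> ->]|[-> ->]] := h e; [right|left].
left; have [jl|lj|jl] := ltngtP j l.
- by have := lt i j k l ij jl; rewrite e ltnn.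
- by have := lt k l i j kl lj; rewrite e ltnn.
- by move: e; rewrite jl => /addIn /eqP; rewrite eqn_exp2l // => /eqP.
Qed.

Section AllGraphs.
Variable R : realType.

(* A functional whose values are the natural numbers [c v], up to the constant
   [b], reduces the genericity of a drawing to arithmetic. *)
Lemma drawing_of_code (G : sgraph) (f : G -> plane R) (w : plane R) (b : R)
    (c : G -> nat) :
  (forall v, dot w (f v) + b = (c v)%:R) -> injective c ->
  (forall u v x y : G, adj u v -> adj x y -> (c u + c v = c x + c y)%N ->
    (u = x /\ v = y) \/ (u = y /\ v = x)) ->
  (forall u v x : G, adj u v -> (c u + c v)%N <> (c x + c x)%N) ->
  is_drawing f.
Proof.
move=> fc cI cM cV; split.
- move=> u v uv; apply: cI; apply/eqP; rewrite -(eqr_nat R) -!fc uv //.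
- move=> u v x y uv xy /(congr1 (dot w)); rewrite !dot_midpoint => e.
  have /eqP : (c u + c v)%:R = (c x + c y)%:R :> R by rewrite !natrD -!fc; lra.
  rewrite eqr_nat => /eqP/(cM _ _ _ _ uv xy) [] [-> ->] //.
  by apply/setP => z; rewrite !inE orbC.
- move=> u v x uv /(congr1 (dot w)); rewrite dot_midpoint => e.
  have /eqP : (c u + c v)%:R = (c x + c x)%:R :> R by rewrite !natrD -!fc; lra.
  by rewrite eqr_nat => /eqP; apply: cV.
Qed.

Lemma drawing_of_abscissa (G : sgraph) (f : G -> plane R) (x : G -> nat) :
  injective x -> (forall v, f v 0 0 = (3 ^ x v)%:R) -> is_drawing f.
Proof.
move=> xI fx; apply: (drawing_of_code (w := point 1 0) (b := 0) (c := fun v => (3 ^ x v)%N)).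
- by move=> v; rewrite /dot !mxE /= fx; lra.
- by move=> u v /eqP; rewrite eqn_exp2l // => /eqP/xI.
- by move=> u v a b uv ab /expn3_sidon[] [/xI -> /xI ->]; [left|right].
- by move=> u v a uv /expn3_sidon[] [/xI eu /xI ev];
    move: uv; rewrite eu ev adj_irrefl.
Qed.

(** The functional is normal to the tangent at [f u], and its gap at [f v] is [(t v - t u) ^+ 2]. *)
Lemma parabola_strictly_convex (I : Type) (f : I -> plane R) (t : I -> R) :
  (forall v, f v = point (t v) (t v ^+ 2)) -> strictly_convex (range f).
Proof.
move=> ft; apply: strictly_convex_of_functional => _ [u _ <-].
exists (point (2 * t u) (-1)) => _ [v _ <-] vu.
have tvu : t v - t u != 0.
  by rewrite subr_eq0; apply: contra_notN vu => /eqP tvu; rewrite !ft tvu.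
have : 0 < (t v - t u) ^+ 2 by rewrite exprn_even_gt0.
by rewrite !ft /dot !mxE /=; lra.
Qed.

Lemma all_graphs_strict_arbitrary G : graph_class R Strict Arbitrary G.
Proof.
pose x (v : G) := nat_of_ord (enum_rank v).
pose t (v : G) : R := (3 ^ x v)%:R.
exists (fun v => point (t v) (t v ^+ 2)); split => //.
  apply: (drawing_of_abscissa (x := x)) => [u v /val_inj/enum_rank_inj //|v].
  by rewrite mxE.
exact: (parabola_strictly_convex (t := t)).
Qed.

(** Both lines bounding the strip support [X]. The case [a = b] covers sets on a single line. *)
Lemma horizontal_weakly_convex (X : set (plane R)) (a b : R) :
  (forall p, X p -> a <= p 0 1 <= b) ->
  (forall p, X p -> p 0 1 = a \/ p 0 1 = b) -> weakly_convex X.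
Proof.
move=> Xab Xor; apply: weakly_convex_of_functional => p Xp.
have n0 (y : R) : y != 0 -> point 0 y != 0.
  by apply: contra_neq => /rowP/(_ 1); rewrite !mxE.
have [pa|pb] := Xor p Xp.
  exists (point 0 (-1)) => [|q /Xab /andP[h1 h2]]; first by rewrite n0 ?oppr_eq0 ?oner_eq0.
  by rewrite /dot !mxE /=; lra.
exists (point 0 1) => [|q /Xab /andP[h1 h2]]; first by rewrite n0 ?oner_eq0.
by rewrite /dot !mxE /=; lra.
Qed.

Lemma all_graphs_weak_weak G : graph_class R Weak Weak G.
Proof.
pose x (v : G) := nat_of_ord (enum_rank v).
exists (fun v => point (3 ^ x v)%:R 0); split => /=.
- apply: (drawing_of_abscissa (x := x)) => [u v /val_inj/enum_rank_inj //|v].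
  by rewrite mxE.
- apply: (@horizontal_weakly_convex _ 0 0) => _ [v _ <-]; rewrite !mxE /= ?lexx //.
  by left.
- apply: (@horizontal_weakly_convex _ 0 0) => _ [u [v [_ ->]]];
    rewrite !mxE /= addr0 mulr0 ?lexx //.
  by left.
Qed.

End AllGraphs.

Definition K4_adj (i j : 'I_4) := i != j.

Lemma K4_adj_sym : symmetric K4_adj.
Proof. by move=> i j; rewrite /K4_adj eq_sym. Qed.

Lemma K4_adj_irrefl : irreflexive K4_adj.
Proof. by move=> i; rewrite /K4_adj eqxx. Qed.

Definition K4 := SGraph K4_adj_sym K4_adj_irrefl.

Definition K23_adj (i j : 'I_5) := (i < 2)%N != (j < 2)%N.

Lemma K23_adj_sym : symmetric K23_adj.
Proof. by move=> i j; rewrite /K23_adj eq_sym. Qed.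

Lemma K23_adj_irrefl : irreflexive K23_adj.
Proof. by move=> i; rewrite /K23_adj eqxx. Qed.

Definition K23 := SGraph K23_adj_sym K23_adj_irrefl.

(** * The graphs K4 and K23 *)

Section SmallGraphs.
Variable R : realType.

Lemma K4_arbitrary_strict : graph_class R Arbitrary Strict K4.
Proof.
pose f (i : 'I_4) : plane R := match val i with
  | 0 => point 2 0 | 1 => point 0 2 | 2 => point (- 2) (- 2) | _ => 0 end.
exists (f : K4 -> plane R); split => //=.
(* The sums of two distinct codes, 4, 5, 7, 9, 11 and 12, are distinct and avoid the doubled codes
   0, 8, 10 and 14. *)
- pose c (i : 'I_4) := nth 0%N [:: 5; 7; 0; 4]%N i.
  apply: (@drawing_of_code R K4 f (point 2^-1 (3 / 2)) 4 c).
  + by case=> [[|[|[|[|//]]]] ?]; rewrite /dot /f /c !mxE /=; field.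
  + by do 2!(case=> [[|[|[|[|//]]]] ?]); move=> //= _; apply/val_inj.
  + by do 4!(case=> [[|[|[|[|//]]]] ?]); move=> //= _ _ _;
      first [left; split; exact/val_inj | right; split; exact/val_inj].
  + by do 3!(case=> [[|[|[|[|//]]]] ?]).
(* The midpoints lie on the ellipse x^2 - xy + y^2 = 1. *)
have ell p : edge_midpoints (f : K4 -> plane R) p ->
    p 0 0 ^+ 2 - p 0 0 * p 0 1 + p 0 1 ^+ 2 = 1.
  case=> u [v [uv ->]]; move: uv; rewrite /= /K4_adj -!val_eqE !mxE /f.
  by move: u v; do 2!(case=> [[|[|[|[|//]]]] ?] /=); move=> // _; rewrite !mxE /=; field.
apply: strictly_convex_of_functional => p /ell hp.
(* This is the gradient of the quadratic form at [p]; the gap at [q] is the value of this positive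
   definite form at [q - p]. *)
exists (point (2 * p 0 0 - p 0 1) (2 * p 0 1 - p 0 0)) => q /ell hq qp.
have /dot_gt0 : q - p != 0 by rewrite subr_eq0; apply/eqP.
rewrite /dot !mxE /=; have := sqr_ge0 (q 0 0 - p 0 0 - (q 0 1 - p 0 1)); lra.
Qed.

Lemma K23_strict_weak : graph_class R Strict Weak K23.
Proof.
(* The part of size two has ordinates 1, 1 and the other one 4, 4, 0, so the midpoints lie at
   heights 5/2 and 1/2. *)
pose t (i : 'I_5) : R := match val i with
  | 0 => -1 | 1 => 1 | 2 => - 2 | 3 => 2 | _ => 0 end.
pose f i := point (t i) (t i ^+ 2).
exists (f : K23 -> plane R); split => /=.
- pose c (i : 'I_5) := nth 0%N [:: 11; 13; 40; 44; 2]%N i.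
  apply: (@drawing_of_code R K23 f (point 1 10) 2 c).
  + by case=> [[|[|[|[|[|//]]]]] ?]; rewrite /dot /f /t /c !mxE /=; field.
  + by do 2!(case=> [[|[|[|[|[|//]]]]] ?]); move=> //= _; apply/val_inj.
  + by do 4!(case=> [[|[|[|[|[|//]]]]] ?]); move=> //= _ _ _;
      first [left; split; exact/val_inj | right; split; exact/val_inj].
  + by do 3!(case=> [[|[|[|[|[|//]]]]] ?]).
- exact: (parabola_strictly_convex (t := t)).
have ab p : edge_midpoints (f : K23 -> plane R) p -> p 0 1 = 1 / 2 \/ p 0 1 = 5 / 2.
  case=> u [v [uv ->]]; move: uv; rewrite /= /K23_adj !mxE /= /t.
  by move: u v; do 2!(case=> [[|[|[|[|[|//]]]]] ?] /=); move=> // _;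
    first [by left; field | by right; field].
apply: (horizontal_weakly_convex (a := 1 / 2) (b := 5 / 2)) => [p /ab|p /ab //].
by case=> ->; apply/andP; split; lra.
Qed.

(** As [n] is normal to [a' - a], [b2] is a convex combination of [b1] and [b3] plus [s] times
    [a' - a]. If [s] is nonnegative, this contradicts the inequalities for [w], otherwise those for
    [w']. *)
Lemma strip_obstruction (a a' b1 b2 b3 w w' : plane R)
    (n := point (- (a' - a) 0 1) ((a' - a) 0 0)) : a != a' ->
  dot n b1 <= dot n b2 -> dot n b2 <= dot n b3 ->
  [/\ dot w a' < dot w a, dot w b1 < dot w b2 & dot w b3 < dot w b2] ->
  [/\ dot w' a < dot w' a', dot w' b1 < dot w' b2 & dot w' b3 < dot w' b2] ->
  False.
Proof.
move=> aa n12 n23 [wa w1 w3] [w'a w'1 w'3].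
have [t [t0 t1 tE]] : exists t, [/\ 0 <= t, t <= 1 &
    dot n (b2 - (1 - t) *: b1 - t *: b3) = 0].
  (* If [dot n] does not separate [b1] from [b3], it agrees on all three points and [t = 0]
     works. *)
  have [n13|n13] := ltP (dot n b1) (dot n b3).
    exists ((dot n b2 - dot n b1) / (dot n b3 - dot n b1)).
    have n0 : 0 < dot n b3 - dot n b1 by lra.
    split; first by rewrite divr_ge0 //; lra.
      by rewrite ler_pdivrMr // mul1r; lra.
    by rewrite !dotE; field; rewrite gt_eqF.
  by exists 0; split => //; rewrite !dotE; lra.
have v0 : a' - a != 0 by rewrite subr_eq0 eq_sym.
have := colinear_of_perp v0 tE; set s := _ / _ => sE.
have bE u : dot u b2 = (1 - t) * dot u b1 + t * dot u b3 + s * (dot u a' - dot u a).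
  by have := congr1 (dot u) sE; rewrite !dotE; lra.
have comb_gt0 (x y : R) : 0 < x -> 0 < y -> 0 < (1 - t) * x + t * y.
  move=> x0 y0; have [t2|t2] := leP t (1 / 2).
    have : 0 < (1 - t) * x by rewrite mulr_gt0 //; lra.
    by have := mulr_ge0 t0 (ltW y0); lra.
  have : 0 < t * y by rewrite mulr_gt0 //; lra.
  have : 0 <= (1 - t) * x by rewrite mulr_ge0 ?subr_ge0 // ltW.
  by lra.
have := bE w; have := bE w'; have [s0|s0] := leP 0 s.
- move=> _ h; have : s * (dot w a' - dot w a) <= 0 by rewrite mulr_ge0_le0 //; lra.
  have := comb_gt0 (dot w b2 - dot w b1) (dot w b2 - dot w b3); lra.
- move=> h _; have : s * (dot w' a' - dot w' a) <= 0 by rewrite mulr_le0_ge0 //; lra.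
  have := comb_gt0 (dot w' b2 - dot w' b1) (dot w' b2 - dot w' b3); lra.
Qed.

Lemma K23_not_arbitrary_strict : ~ graph_class R Arbitrary Strict K23.
Proof.
case=> f [[fI fm _] _ sc].
pose o (k : nat) : K23 := inord k.
have oK k : (k < 5)%N -> val (o k) = k by move=> k5; rewrite /o /= inordK.
have w_ i j : (i < 2)%N -> (1 < j < 5)%N -> exists w, forall i' j',
    (i' < 2)%N -> (1 < j' < 5)%N -> (i', j') != (i, j) ->
    dot w (f (o i')) + dot w (f (o j')) < dot w (f (o i)) + dot w (f (o j)).
  move=> i2 /andP[j1 j5].
  have adj_o i' j' : (i' < 2)%N -> (1 < j' < 5)%N -> adj (o i') (o j').
    move=> i'2 /andP[j'1 j'5]; rewrite /= /K23_adj !oK ?i'2 ?(leq_trans i'2) //.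
    by rewrite ltnNge j'1.
  have Xij := edge_midpoints_adj f (adj_o i j i2 (introT andP (conj j1 j5))).
  have [w wP] := strict_functional (finite_edge_midpoints f) sc Xij.
  exists w => i' j' i'2 j'5 ne.
  have := wP _ (edge_midpoints_adj f (adj_o i' j' i'2 j'5)).
  rewrite !dot_midpoint ltr_pM2l ?invr_gt0 //; apply.
  move=> /fm - /(_ (adj_o _ _ i'2 j'5)) /(_ (adj_o _ _ i2 (introT andP (conj j1 j5)))).
  move=> /setP eS; case/negP: ne.
  move: j'5 => /andP[j'1 j'5].
  have := eS (o i'); have := eS (o j'); rewrite !inE -!val_eqE /= !oK //; try lia.
  rewrite !eqxx orbT /= xpair_eqE; lia.
(* No [j2] can be the middle one in the order given by [n]: the functionals of the edges from [0]
   and [1] to [j2] are those of [strip_obstruction]. *)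
have mid j1 j2 j3 (n := point (- (f (o 1) - f (o 0)) 0 1) ((f (o 1) - f (o 0)) 0 0)) :
    (1 < j1 < 5)%N -> (1 < j2 < 5)%N -> (1 < j3 < 5)%N -> j1 != j2 -> j3 != j2 ->
    dot n (f (o j1)) <= dot n (f (o j2)) -> dot n (f (o j2)) <= dot n (f (o j3)) -> False.
  move=> j1P j2P j3P j12 j32 n12 n23.
  have [w wP] := w_ 0%N j2 isT j2P; have [w' w'P] := w_ 1%N j2 isT j2P.
  apply: (strip_obstruction (w := w) (w' := w') _ n12 n23).
  - by apply/eqP => /fI/(congr1 val); rewrite !oK.
  - split.
    + by have := wP 1%N j2 isT j2P isT; rewrite ltrD2r.
    + have := wP 0%N j1 isT j1P; rewrite xpair_eqE j12 => /(_ isT).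
      by rewrite ltrD2l.
    + have := wP 0%N j3 isT j3P; rewrite xpair_eqE j32 => /(_ isT).
      by rewrite ltrD2l.
  - split.
    + by have := w'P 0%N j2 isT j2P isT; rewrite ltrD2r.
    + have := w'P 1%N j1 isT j1P; rewrite xpair_eqE j12 => /(_ isT).
      by rewrite ltrD2l.
    + have := w'P 1%N j3 isT j3P; rewrite xpair_eqE j32 => /(_ isT).
      by rewrite ltrD2l.
pose n := point (- (f (o 1) - f (o 0)) 0 1) ((f (o 1) - f (o 0)) 0 0).
(* Each of the eight outcomes, the cyclic ones included, contains a chain through all three
   vertices. *)
have [h23|/ltW h23] := leP (dot n (f (o 2))) (dot n (f (o 3)));
have [h24|/ltW h24] := leP (dot n (f (o 2))) (dot n (f (o 4)));
have [h34|/ltW h34] := leP (dot n (f (o 3))) (dot n (f (o 4))).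
- exact: (mid 2 3 4)%N.
- exact: (mid 2 4 3)%N.
- exact: (mid 2 3 4)%N.
- exact: (mid 4 2 3)%N.
- exact: (mid 3 2 4)%N.
- exact: (mid 4 3 2)%N.
- exact: (mid 3 4 2)%N.
- exact: (mid 4 3 2)%N.
Qed.
End SmallGraphs.

(** * Four points in strictly convex position *)

Section CompleteGraphObstruction.
Variable R : realType.

(** One of three collinear points lies between the other two, and no functional has a strict maximum
    there. *)
Lemma colinear_obstruction (w a b c ua ub uc : plane R) : w != 0 ->
  dot w a = dot w b -> dot w a = dot w c ->
  dot ua b < dot ua a -> dot ua c < dot ua a ->
  dot ub a < dot ub b -> dot ub c < dot ub b ->
  dot uc a < dot uc c -> dot uc b < dot uc c -> False.
Proof.
move=> w0 wab wac uab uac uba ubc uca ucb.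
pose e := point (w 0 1) (- w 0 0).
have e0 : e != 0.
  apply: contra_neq w0 => /rowP e0; apply: plane_eq; rewrite mxE.
    by have := e0 1; rewrite !mxE /=; lra.
  by have := e0 0; rewrite !mxE /=; lra.
have onl q : dot w q = 0 -> q = (dot e q / dot e e) *: e.
  move=> wq; apply: colinear_of_perp => //; rewrite -wq; congr dot.
  by apply: plane_eq; rewrite !mxE /=; lra.
have [s bE] : exists s, forall u, dot u b - dot u a = s * dot u e.
  exists (dot e (b - a) / dot e e) => u; rewrite -dotBr -dotZr -onl //.
  by rewrite dotBr wab subrr.
have [r cE] : exists r, forall u, dot u c - dot u a = r * dot u e.
  exists (dot e (c - a) / dot e e) => u; rewrite -dotBr -dotZr -onl //.
  by rewrite dotBr wac subrr.
have := bE ua; have := bE ub; have := bE uc.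
have := cE ua; have := cE ub; have := cE uc.
move: (dot ua e) (dot ub e) (dot uc e) => x y z c3 c2 c1 b3 b2 b1.
have {bE cE} h1 : s * x < 0 by lra.
have h2 : r * x < 0 by lra.
have h3 : 0 < s * y by lra.
have h4 : 0 < (s - r) * y by lra.
have h5 : 0 < r * z by lra.
have h6 : 0 < (r - s) * z by lra.
clear -h1 h2 h3 h4 h5 h6.
have [s0|s0|s0] := ltrgtP s 0; last by move: h3; rewrite s0 mul0r ltxx.
- have x0 : 0 < x by move: h1; rewrite nmulr_rlt0.
  have r0 : r < 0 by move: h2; rewrite pmulr_llt0.
  have z0 : z < 0 by move: h5; rewrite nmulr_rgt0.
  have y0 : y < 0 by move: h3; rewrite nmulr_rgt0.
  move: h4 h6; rewrite !nmulr_lgt0 //; lra.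
- have x0 : x < 0 by move: h1; rewrite pmulr_rlt0.
  have r0 : 0 < r by move: h2; rewrite nmulr_llt0.
  have z0 : 0 < z by move: h5; rewrite pmulr_rgt0.
  have y0 : 0 < y by move: h3; rewrite pmulr_rgt0.
  move: h4 h6; rewrite !pmulr_lgt0 //; lra.
Qed.

(** The rows [(x, y, 1)] of the four points form a matrix of rank at most 3, so its left kernel is
    nonzero. *)
Lemma affine_dependence (f : 'I_4 -> plane R) : exists2 l : 'I_4 -> R,
  exists i, l i != 0 &
  \sum_i l i = 0 /\ forall w, \sum_i l i * dot w (f i) = 0.
Proof.
pose A : 'M[R]_(4, 3) := \matrix_(i, j)
  (if j == 0 then f i 0 0 else if j == 1 then f i 0 1 else 1).
have : kermx A != 0.
  rewrite kermx_eq0 /row_free; apply/negP => /eqP rA.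
  by have := rank_leq_col A; rewrite rA.
case/rowV0Pn => v /sub_kermxP vA v0.
exists (v 0); first by apply/rV0Pn.
have h0 : \sum_i v 0 i * f i 0 0 = 0.
  have /rowP/(_ 0) := vA; rewrite mxE [RHS]mxE => e; rewrite -[RHS]e.
  by apply: eq_bigr => i _; rewrite mxE.
have h1 : \sum_i v 0 i * f i 0 1 = 0.
  have /rowP/(_ 1) := vA; rewrite mxE [RHS]mxE => e; rewrite -[RHS]e.
  by apply: eq_bigr => i _; rewrite mxE.
have h2 : \sum_i v 0 i = 0.
  have /rowP/(_ 2) := vA; rewrite mxE [RHS]mxE => e; rewrite -[RHS]e.
  by apply: eq_bigr => i _; rewrite mxE mulr1.
split=> // w.
transitivity (w 0 0 * (\sum_i v 0 i * f i 0 0) + w 0 1 * (\sum_i v 0 i * f i 0 1)).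
  rewrite !mulr_sumr -big_split; apply: eq_bigr => i _; rewrite /dot /=; ring.
by rewrite h0 h1 !mulr0 addr0.
Qed.

(* Otherwise the only point with a positive coefficient would be a convex
   combination of the others. *)
Lemma two_positive (I : finType) (f : I -> plane R) (l : I -> R) :
  (forall i, exists w, forall j, j != i -> dot w (f j) < dot w (f i)) ->
  (exists i, l i != 0) -> \sum_i l i = 0 ->
  (forall w, \sum_i l i * dot w (f i) = 0) ->
  exists i j, [/\ i != j, 0 < l i & 0 < l j].
Proof.
move=> fS [k lk] l0 lf.
have [i li] : exists i, 0 < l i.
  apply: contrapT => nl; case/negP: lk; rewrite -oppr_eq0; apply/eqP.
  apply: (psumr_eq0P (P := predT) (F := fun i => - l i)) => // [i _|].
    by rewrite oppr_ge0 leNgt; apply/negP => li; apply: nl; exists i.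
  by rewrite sumrN l0 oppr0.
apply: contrapT => nl.
have lj j : j != i -> l j <= 0.
  by move=> ji; rewrite leNgt; apply/negP => lj; apply: nl; exists j, i.
have [w wi] := fS i.
have z j : l j * (dot w (f j) - dot w (f i)) = 0.
  apply: (psumr_eq0P (P := predT) (F := fun j => l j * (dot w (f j) - dot w (f i)))) => //.
    move=> x _; have [->|xi] := eqVneq x i; first by rewrite subrr mulr0.
    by rewrite mulr_le0 ?lj // subr_le0 ltW // wi.
  by under eq_bigr do rewrite mulrBr; rewrite sumrB lf -mulr_suml l0 mul0r subrr.
have lj0 j : j != i -> l j = 0.
  move=> ji; have /eqP := z j; rewrite mulf_eq0 => /orP[/eqP //|].
  by rewrite subr_eq0 => /eqP e; have := wi _ ji; rewrite e ltxx.
by move: l0; rewrite (bigD1 i) //= big1 // addr0 => e; rewrite e ltxx in li.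
Qed.

Lemma sum_four (i j k m : 'I_4) (F : 'I_4 -> R) : uniq [:: i; j; k; m] ->
  \sum_x F x = F i + F j + F k + F m.
Proof.
move=> u; rewrite -[LHS]big_enum /=.
have sub : {subset [:: i; j; k; m] <= enum 'I_4} by move=> x _; rewrite mem_enum.
have [|_ e] := uniq_min_size u sub; first by rewrite size_enum_ord.
rewrite (perm_big [:: i; j; k; m]) /=; last first.
  by apply: uniq_perm; rewrite ?enum_uniq // => x; rewrite -e.
by rewrite !big_cons big_nil addr0 !addrA.
Qed.

(* The midpoint of a diagonal of the quadrilateral is interior to the
   parallelogram of the midpoints of the sides: a line supporting the midpoints
   there would contain all four vertices. *)
Lemma K4_not_strict_weak : ~ graph_class R Strict Weak K4.
Proof.
case=> f [[fI _ _] sc wc].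
have fS i : exists w, forall j, j != i -> dot w (f j) < dot w (f i).
  have fi : range f (f i) by exists i.
  have [w wi] := strict_functional (finite_range f) sc fi.
  by exists w => j /eqP ji; apply: wi => [|/fI //]; exists j.
have [l lN0 [l0 lf]] := affine_dependence f.
(* As in Radon's theorem, two coefficients are positive and two negative; [i j] and [k m] are the
   diagonals. *)
have [i [j [ij li lj]]] := two_positive fS lN0 l0 lf.
have [||w|k [m [km lk lm]]] := two_positive (l := fun x => - l x) fS.
- by case: lN0 => x lx; exists x; rewrite oppr_eq0.
- by rewrite sumrN l0 oppr0.
- by under eq_bigr do rewrite mulNr; rewrite sumrN lf oppr0.
have dif x y : 0 < l x -> 0 < - l y -> x != y.
  by move=> lx ly; apply/eqP => xy; rewrite xy in lx; lra.
have ik := dif _ _ li lk; have im := dif _ _ li lm.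
have jk := dif _ _ lj lk; have jm := dif _ _ lj lm.
have u4 : uniq [:: i; j; k; m] by rewrite /= !inE !negb_or ij ik im jk jm km.
have [w w0 wij] := weak_functional (finite_edge_midpoints f) wc
  (edge_midpoints_adj f (ij : adj (i : K4) j)).
have W x y : x != y -> dot w (f x) + dot w (f y) <= dot w (f i) + dot w (f j).
  move=> xy; have := wij _ (edge_midpoints_adj f (xy : adj (x : K4) y)).
  by rewrite !dot_midpoint ler_pM2l // invr_gt0.
have := lf w; have := l0; rewrite !(sum_four _ u4) => s0 sf.
have h1 := W _ _ ik; have h2 := W _ _ im; have h3 := W _ _ jk; have h4 := W _ _ jm.
(* By [W], [w] is at least as large at [i] and [j] as at [k] and [m]. The affine dependence makes a
   sum of these gaps with positive weights vanish, so each gap is zero. *)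
have [eij eik] : dot w (f i) = dot w (f j) /\ dot w (f i) = dot w (f k).
  move: (dot w (f i)) (dot w (f j)) (dot w (f k)) (dot w (f m)) (l i) (l j) (l k) (l m)
    li lj lk lm s0 sf h1 h2 h3 h4 => a b c d x y z t x0 y0 z0 t0 s0 sf h1 h2 h3 h4.
  have p1 : 0 <= x * - z * (a - c) by rewrite !mulr_ge0 ?subr_ge0 ?(ltW x0) ?(ltW z0) //; lra.
  have p2 : 0 <= x * - t * (a - d) by rewrite !mulr_ge0 ?subr_ge0 ?(ltW x0) ?(ltW t0) //; lra.
  have p3 : 0 <= y * - z * (b - c) by rewrite !mulr_ge0 ?subr_ge0 ?(ltW y0) ?(ltW z0) //; lra.
  have p4 : 0 <= y * - t * (b - d) by rewrite !mulr_ge0 ?subr_ge0 ?(ltW y0) ?(ltW t0) //; lra.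
  have p : x * - z * (a - c) + x * - t * (a - d) + y * - z * (b - c)
      + y * - t * (b - d) = 0.
    transitivity ((x + y) * (x * a + y * b + z * c + t * d)
      - (x + y + z + t) * (x * a + y * b)); first ring.
    by rewrite sf s0 mulr0 mul0r subr0.
  have /eqP : x * - z * (a - c) = 0 by lra.
  have /eqP : y * - z * (b - c) = 0 by lra.
  by rewrite !mulf_eq0 !(gt_eqF x0, gt_eqF y0, gt_eqF z0) !subr_eq0 /= => /eqP -> /eqP ->.
have [ui hi] := fS i; have [uj hj] := fS j; have [uk hk] := fS k.
have [ji ki kj] : [/\ j != i, k != i & k != j] by rewrite ![_ == i]eq_sym [k == j]eq_sym.
exact: (colinear_obstruction w0 eij eik (hi _ ji) (hi _ ki) (hj _ ij) (hj _ kj)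
  (hk _ ik) (hk _ jk)).
Qed.
End CompleteGraphObstruction.

(** * Bending weakly convex drawings *)

Section Perturbation.
Variable R : realType.

Lemma dot_sum (I : finType) (w : plane R) (F : I -> plane R) :
  dot w (\sum_i F i) = \sum_i dot w (F i).
Proof.
by rewrite (big_morph (dot w) (dotDr w) (id1 := 0)) // dotC dot0l.
Qed.

(* Any point off the line works for collinear points; otherwise the barycentre
   lies strictly inside every supporting half-plane. *)
Lemma exists_center (I : finType) (f : I -> plane R) : weakly_convex (range f) ->
  exists o, forall i, exists w,
    dot w (f i - o) = 1 /\ forall j, dot w (f j - o) <= 1.
Proof.
move=> wc.
have fin : finite_set (range f) by exact/finite_image/finite_finset.
have [[w [w0 wE]]|nw] :=
  pselect (exists w, w != 0 /\ forall i j, dot w (f i) = dot w (f j)).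
  have [i0 _|noI] := pickP (@predT I); last by exists 0 => i; have := noI i.
  have ww := dot_gt0 w0.
  (* Here [w] is constant on the points; stepping off their line by [w] and rescaling gives the
     value 1 at all of them. *)
  have wo i : dot ((dot w w)^-1 *: w) (f i - (f i0 - w)) = 1.
    by rewrite dotZl !dotBr (wE i i0) subKr mulVf // gt_eqF.
  exists (f i0 - w) => i; exists ((dot w w)^-1 *: w).
  by split=> [//|j]; rewrite wo.
exists (#|I|%:R^-1 *: \sum_j f j) => i; set o := _ *: _.
have [|w w0 wi] := weak_functional fin wc (p := f i); first by exists i.
have I0 : (0 < #|I|)%N by apply/card_gt0P; exists i.
have nI : #|I|%:R != 0 :> R by rewrite pnatr_eq0 -lt0n.
have wj j : 0 <= dot w (f i) - dot w (f j) by rewrite subr_ge0 wi //; exists j.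
have sE : \sum_j (dot w (f i) - dot w (f j)) = #|I|%:R * dot w (f i - o).
  rewrite sumrB sumr_const dotBr /o dotZr dot_sum mulrBr mulrA mulfV // mul1r.
  by rewrite mulr_natl.
(* If this vanished, all gaps would be zero and [w] would be constant on the points, against
   [nw]. *)
have pos : 0 < dot w (f i - o).
  rewrite -(pmulr_rgt0 _ (x := #|I|%:R)) ?ltr0n // -sE lt_def.
  apply/andP; split; last by apply: sumr_ge0.
  apply/eqP => s0; apply: nw; exists w; split => // j k.
  have z x : dot w (f i) = dot w (f x).
    apply/eqP; rewrite -subr_eq0; apply/eqP.
    exact: (psumr_eq0P (P := predT) (F := fun x => dot w (f i) - dot w (f x))).
  by rewrite -!z.
exists ((dot w (f i - o))^-1 *: w).
split=> [|j]; rewrite dotZl; first by rewrite mulVf // gt_eqF.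
by rewrite mulrC ler_pdivrMr // mul1r !dotBr lerD2r wi //; exists j.
Qed.

(** The strict inequalities needed for the bent drawing all take this form, one of them after
    division by [e]. *)
Lemma near_quadratic_gt0 (c k m : R) : 0 < c ->
  \forall e \near 0^'+, 0 < c + e * (k + e * m).
Proof.
move=> c0; pose d := `|k| + `|m| + 1.
have d0 : 0 < d by rewrite /d; have := normr_ge0 k; have := normr_ge0 m; lra.
near=> e.
have e0 : 0 < e by near: e; exact: nbhs_right_gt.
have e1 : e < 1 by near: e; apply: nbhs_right_lt; lra.
have ec : e < c / d by near: e; apply: nbhs_right_lt; exact: divr_gt0.
have ed : e * d < c by rewrite -ltr_pdivlMr.
have : - (e * d) <= e * (k + e * m); last lra.
rewrite -mulrN ler_pM2l // /d.
have : - `|k| <= k by rewrite lerNl ler_normr lexx orbT.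
have : - `|m| <= e * m; last lra.
have : - `|m| <= m by rewrite lerNl ler_normr lexx orbT.
have := normr_ge0 m; nra.
Unshelve. all: by end_near. Qed.

Lemma near_imply (F : set_system R) (P : Prop) (Q : R -> Prop) : Filter F ->
  (P -> \forall e \near F, Q e) -> \forall e \near F, P -> Q e.
Proof.
move=> FF PQ; have [/PQ|nP] := pselect P; first by apply: filterS => e Qe _.
by apply: filterE => e /nP.
Qed.

Lemma midpoint_set2 (T : finType) (g : T -> plane R) u v x y :
  [set u; v]%SET = [set x; y]%SET ->
  midpoint (g u) (g v) = midpoint (g x) (g y).
Proof.
move=> /setP e.
have hu : (u == x) || (u == y) by have := e u; rewrite !inE eqxx.
have hv : (v == x) || (v == y) by have := e v; rewrite !inE eqxx orbT.
have hx : (x == u) || (x == v) by have := e x; rewrite !inE eqxx.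
have hy : (y == u) || (y == v) by have := e y; rewrite !inE eqxx orbT.
case/orP: hu hx hy => /eqP->; case/orP: hv => /eqP-> //; rewrite ?orbb.
- by move=> _ /eqP->.
- by rewrite /midpoint addrC.
- by move=> /eqP->.
Qed.

(* Moving [f i] towards the centre [a] by the factor [1 - e |f i - a|^2] bends each side of
   the hull outwards: on the side supported by [w i] the functional
   [w i + 2 e (f i - a)] drops by [e |f i - f j|^2] to first order in [e]. *)
Lemma weak_strict_sub_strict_strict :
  class_sub (graph_class R Weak Strict) (graph_class R Strict Strict).
Proof.
move=> G [f [[fI fM fV] /= wc sc]].
have [a /choice[w wP]] := exists_center wc.
pose h i := f i - a.
pose N i := dot (h i) (h i).
pose g e i := f i - (e * N i) *: h i.
have dg u e i : dot u (g e i) = dot u (f i) - e * N i * dot u (h i).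
  by rewrite /g dotBr dotZr.
have gV : \forall e \near 0^'+, forall ij : G * G, ij.1 != ij.2 ->
    dot (w ij.1 + (2 * e) *: h ij.1) (g e ij.2) <
    dot (w ij.1 + (2 * e) *: h ij.1) (g e ij.1).
  apply: filter_forall => -[i j] /=; apply: near_imply => ij.
  have [wi wj] := wP i; have {wj} := wj j; rewrite -/(h i) -/(h j) in wi *.
  have dE e : dot (w i + (2 * e) *: h i) (g e i) - dot (w i + (2 * e) *: h i) (g e j) =
     (1 - dot (w i) (h j)) + e * ((N i + N j * dot (w i) (h j) - 2 * dot (h i) (h j))
       + e * (2 * N j * dot (h i) (h j) - 2 * N i ^+ 2)).
    have fE u x : dot u (f x) = dot u (h x) + dot u a by rewrite -dotDr /h subrK.
    by rewrite !dg !fE !(dotDl (w i)) !(dotZl (2 * e)) wi -/(N i); ring.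
  (* If [f j] is on the line supporting at [f i], the constant term of [dE] vanishes and the
     coefficient of [e] is the squared distance; otherwise the constant term is positive. *)
  rewrite le_eqVlt => /predU1P[l1|l1].
    have n0 : 0 < N i + N j - 2 * dot (h i) (h j).
      have : 0 < dot (h i - h j) (h i - h j).
        apply: dot_gt0; rewrite /h opprB addrA subrK subr_eq0.
        by apply: contra_neq ij => /fI.
      by rewrite /N /dot !mxE; lra.
    near=> e; rewrite -subr_gt0 dE l1 subrr add0r mulr1; apply: mulr_gt0.
      by near: e; exact: nbhs_right_gt.
    have : 0 < N i + N j - 2 * dot (h i) (h j) +
      e * ((2 * N j * dot (h i) (h j) - 2 * N i ^+ 2) + e * 0).
      by near: e; exact: near_quadratic_gt0.
    by rewrite mulr0 addr0.
  by near=> e; rewrite -subr_gt0 dE; near: e; apply: near_quadratic_gt0; rewrite subr_gt0.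
(* The functionals of the midpoints are fixed before [e], so only finitely many inequalities have to
   survive. *)
have /choice[W WP] (uv : G * G) : exists W, adj uv.1 uv.2 -> forall x y, adj x y ->
    midpoint (f x) (f y) <> midpoint (f uv.1) (f uv.2) ->
    dot W (midpoint (f x) (f y)) < dot W (midpoint (f uv.1) (f uv.2)).
  have [uvE|nuv] := boolP (adj uv.1 uv.2); last by exists 0.
  have [W WP] := strict_functional (finite_edge_midpoints f) sc (edge_midpoints_adj f uvE).
  by exists W => _ x y xy; apply: WP; apply: edge_midpoints_adj.
have gE : \forall e \near 0^'+, forall q : (G * G) * (G * G),
    [/\ adj q.1.1 q.1.2, adj q.2.1 q.2.2 &
      midpoint (f q.2.1) (f q.2.2) <> midpoint (f q.1.1) (f q.1.2)] ->
    dot (W q.1) (midpoint (g e q.2.1) (g e q.2.2)) <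
    dot (W q.1) (midpoint (g e q.1.1) (g e q.1.2)).
  apply: filter_forall => -[[u v] [x y]] /=; apply: near_imply => -[uv xy ne].
  have := WP (u, v) uv x y xy ne; rewrite -subr_gt0 /= => c0.
  near=> e; rewrite -subr_gt0.
  have : 0 < dot (W (u, v)) (midpoint (f u) (f v)) - dot (W (u, v)) (midpoint (f x) (f y))
    + e * (2^-1 * (N x * dot (W (u, v)) (h x) + N y * dot (W (u, v)) (h y)
      - N u * dot (W (u, v)) (h u) - N v * dot (W (u, v)) (h v)) + e * 0).
    by near: e; exact: near_quadratic_gt0.
  by rewrite !dot_midpoint !dg; lra.
have gM : \forall e \near 0^'+, forall q : (G * G) * G, adj q.1.1 q.1.2 ->
    midpoint (g e q.1.1) (g e q.1.2) <> g e q.2.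
  apply: filter_forall => -[[u v] x] /=; apply: near_imply => uv.
  (* The functional [z] itself separates the midpoint from the vertex, by [dot z z]. *)
  pose z := midpoint (f u) (f v) - f x.
  have z0 : 0 < dot z z by apply: dot_gt0; rewrite subr_eq0; apply/eqP/fV.
  have {}z0 : 0 < dot z (midpoint (f u) (f v)) - dot z (f x) by rewrite -dotBr.
  near=> e => /(congr1 (dot z)).
  have : 0 < dot z (midpoint (f u) (f v)) - dot z (f x)
    + e * ((N x * dot z (h x) - 2^-1 * (N u * dot z (h u) + N v * dot z (h v))) + e * 0).
    by near: e; exact: near_quadratic_gt0.
  by rewrite !dot_midpoint !dg; lra.
have [e [[eV eE] eM]] := filter_ex (filterI (filterI gV gE) gM).
exists (g e); split; [split| |] => /=.
- move=> i j gij; apply: contrapT => /eqP ij.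
  by have := eV (i, j) ij; rewrite /= gij ltxx.
- move=> u v x y uv xy gm; apply: fM => //; apply: contrapT => ne.
  have := eE ((u, v), (x, y)); rewrite /= gm ltxx => H; suff : false by [].
  by apply: H; split => // E; apply: ne.
- by move=> u v x uv; apply: (eM ((u, v), x)).
- apply: strictly_convex_of_functional => _ [i _ <-].
  exists (w i + (2 * e) *: h i) => _ [j _ <-] ji.
  by apply: (eV (i, j)); apply/eqP => /= ij; rewrite ij in ji.
- apply: strictly_convex_of_functional => _ [u [v [uv ->]]].
  exists (W (u, v)) => _ [x [y [xy ->]]] ne.
  (* Equal midpoints under [f] belong to the same edge, hence are equal under [g e] as well. *)
  apply: (eE ((u, v), (x, y))); split => //= fe; apply: ne.
  exact/midpoint_set2/fM.
Unshelve. all: by end_near. Qed.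

End Perturbation.

(** * The relations among the classes *)

Lemma class_sub_position (R : realType) (i i' j j' : position) :
  (forall X : set (plane R), in_position i X -> in_position i' X) ->
  (forall X : set (plane R), in_position j X -> in_position j' X) ->
  class_sub (graph_class R i j) (graph_class R i' j').
Proof. by move=> ii jj G [f [df fi fj]]; exists f; split; auto. Qed.

Theorem theorem1 (R : realType) :
  let Gss := graph_class R Strict Strict in
  let Gsw := graph_class R Strict Weak in
  let Gsa := graph_class R Strict Arbitrary in
  let Gws := graph_class R Weak Strict in
  let Gww := graph_class R Weak Weak in
  let Gwa := graph_class R Weak Arbitrary in
  let Gas := graph_class R Arbitrary Strict in
  let Gaw := graph_class R Arbitrary Weak in
  let Gaa := graph_class R Arbitrary Arbitrary in
  (class_eq Gss Gws /\ class_proper Gws Gsw /\ class_proper Gsw Gww /\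
   class_eq Gww Gaw /\ class_eq Gaw Gsa /\ class_eq Gsa Gwa /\
   class_eq Gwa Gaa) /\
  (class_proper Gss Gas /\ class_proper Gas Gww) /\
  (~ class_sub Gas Gsw /\ ~ class_sub Gsw Gas).
Proof.
move=> Gss Gsw Gsa Gws Gww Gwa Gas Gaw Gaa.
have sw X : in_position Strict X -> @in_position R Weak X.
  exact: strictly_convex_weakly.
have all_ww G : Gww G := all_graphs_weak_weak R G.
have all_sa G : Gsa G := all_graphs_strict_arbitrary R G.
have all_aw G : Gaw G by apply: class_sub_position (all_ww G).
have all_wa G : Gwa G by apply: class_sub_position (all_sa G).
have all_aa G : Gaa G by apply: class_sub_position (all_sa G).
have ss_ws : class_sub Gss Gws by apply: class_sub_position.
have ss_sw : class_sub Gss Gsw by apply: class_sub_position.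
have ss_as : class_sub Gss Gas by apply: class_sub_position.
have ws_ss : class_sub Gws Gss := @weak_strict_sub_strict_strict R.
have K4as : Gas K4 := K4_arbitrary_strict R.
have K4sw : ~ Gsw K4 := @K4_not_strict_weak R.
have K23sw : Gsw K23 := K23_strict_weak R.
have K23as : ~ Gas K23 := @K23_not_arbitrary_strict R.
split; [split; [|split; [|split]]|split; [split|]].
- by move=> G; split; [apply: ss_ws|apply: ws_ss].
(* [K23] lies outside [Gws], because [Gws] is contained in [Gas] through [Gss]. *)
- split=> [G /ws_ss/ss_sw //|sub].
  by apply/K23as/ss_as/ws_ss/sub.
- by split=> [G _ //|sub]; apply/K4sw/sub.
- by [].
- by split=> [//|sub]; apply/K4sw/ss_sw/sub.
- by split=> [G _ //|sub]; apply/K23as/sub.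
- by split=> sub; [apply/K4sw/sub|apply/K23as/sub].
Qed.
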